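(* Let $\vec{v}\in\mathbb{R}^3$ be a unit vector. Cylindrical $\lambda$-translators with speed $\vec{v}$ are either planes orthogonal to $\vec{v}$ (in which case $\lambda=\pm 1$) or translators (that is, $\lambda=0$) whose rulings are parallel to $\vec{v}$.
   Context: Let $\vec{v}\in\mathbb{R}^3$ with $|\vec{v}|=1$ and $\lambda\in\mathbb{R}$. A surface $\Sigma$ immersed in Euclidean space $\mathbb{R}^3$, with unit normal vector $N$ and Gauss curvature $K$, is a $\lambda$-translator with speed $\vec{v}$ if $K=\langle N,\vec{v}\rangle+\lambda$ on $\Sigma$. A $\lambda$-translator with $\lambda=0$ is called a translator. A cylindrical surface is a surface invariant by a one-parameter group of translations, equivalently a ruled surface whose rulings are all parallel straight lines: $\Sigma=\{\gamma(s)+t\vec{w}: s\in I,\ t\in\mathbb{R}\}$, where $I\subset\mathbb{R}$ is an interval, $\vec{w}$ is a fixed unit vector, and the base curve $\gamma:I\to\mathbb{R}^3$ is parametrized by arc-length and can be chosen to lie in a plane orthogonal to $\vec{w}$; the rulings are the lines $t\mapsto\gamma(s)+t\vec{w}$.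
   Formalization: As printed the claim fails for planes oblique to v (K=0, λ=-⟨N,v⟩, 0<|λ|<1) and for strips of planes parallel to v ruled in another direction; the formal theorem adds a third alternative: a plane (or strip) not orthogonal to v, rulings not parallel to v, λ=-⟨n,v⟩. *)

(* Defs.v *)
From HB Require Import structures.
From mathcomp Require Import all_boot all_order all_algebra.
From mathcomp Require Import all_classical all_reals all_analysis.

Set Implicit Arguments.
Unset Strict Implicit.
Unset Printing Implicit Defensive.
Import Order.TTheory GRing.Theory Num.Theory.
Import numFieldNormedType.Exports.
Local Open Scope classical_set_scope.
Local Open Scope ring_scope.

(* The library norm on 'rV[R]_3 is the sup norm: Euclidean lengths and angles
   are expressed with [dot] only. *)
Definition dot (R : realType) (x y : 'rV[R]_3) : R :=
  \sum_(i < 3) x ord0 i * y ord0 i.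

Definition unit_vector (R : realType) (x : 'rV[R]_3) : Prop := dot x x = 1.

(* Meant for y != 0. *)
Definition parallel (R : realType) (x y : 'rV[R]_3) : Prop :=
  exists k : R, x = k *: y.

Definition plane (R : realType) (n : 'rV[R]_3) (c : R) : set 'rV[R]_3 :=
  [set x | dot x n = c].

(* Parametrized surfaces X : U -> R^3, with U an open set of parameters. *)

Definition du (R : realType) (X : R * R -> 'rV[R]_3) : R * R -> 'rV[R]_3 :=
  fun p => 'D_((1, 0) : R * R) X p.

Definition dv (R : realType) (X : R * R -> 'rV[R]_3) : R * R -> 'rV[R]_3 :=
  fun p => 'D_((0, 1) : R * R) X p.

Definition C1_on (R : realType) (U : set (R * R)) (X : R * R -> 'rV[R]_3) :
    Prop :=
  forall p, U p ->
    [/\ derivable X p (1, 0), derivable X p (0, 1),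
        {for p, continuous (du X)} & {for p, continuous (dv X)}].

Definition C2_on (R : realType) (U : set (R * R)) (X : R * R -> 'rV[R]_3) :
    Prop :=
  [/\ C1_on U X, C1_on U (du X) & C1_on U (dv X)].

Definition immersed_surface (R : realType) (U : set (R * R))
    (X : R * R -> 'rV[R]_3) : Prop :=
  [/\ open U, C2_on U X &
      forall p, U p -> row_free (col_mx (du X p) (dv X p))].

Definition unit_normal (R : realType) (U : set (R * R))
    (X N : R * R -> 'rV[R]_3) : Prop :=
  forall p, U p ->
    [/\ unit_vector (N p), dot (N p) (du X p) = 0, dot (N p) (dv X p) = 0 &
        {for p, continuous N}].

(* K = (e g - f^2) / (E G - F^2), from the coefficients of the two fundamental
   forms of X, the second one being taken with respect to N. *)
Definition gauss_curvature (R : realType) (X N : R * R -> 'rV[R]_3)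
    (p : R * R) : R :=
  let E := dot (du X p) (du X p) in
  let F := dot (du X p) (dv X p) in
  let G := dot (dv X p) (dv X p) in
  let e := dot (du (du X) p) (N p) in
  let f := dot (dv (du X) p) (N p) in
  let g := dot (dv (dv X) p) (N p) in
  (e * g - f ^+ 2) / (E * G - F ^+ 2).

Definition lambda_translator (R : realType) (v : 'rV[R]_3) (lambda : R)
    (U : set (R * R)) (X N : R * R -> 'rV[R]_3) : Prop :=
  [/\ immersed_surface U X, unit_normal U X N &
      forall p, U p -> gauss_curvature X N p = dot (N p) v + lambda].

Definition cyl_dom (R : realType) (I : set R) : set (R * R) :=
  [set p | I p.1].

Definition cyl_map (R : realType) (gamma : R -> 'rV[R]_3) (w : 'rV[R]_3) :
    R * R -> 'rV[R]_3 :=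
  fun p => gamma p.1 + p.2 *: w.

(* I is an open interval because a surface has no boundary; I = R is allowed. *)
Definition cylindrical (R : realType) (I : set R) (gamma : R -> 'rV[R]_3)
    (w : 'rV[R]_3) : Prop :=
  [/\ [/\ open I, is_interval I & I !=set0],
      unit_vector w,
      forall s, I s -> derivable gamma s 1 /\ unit_vector (derive1 gamma s) &
      exists c, forall s, I s -> plane w c (gamma s)].

(* The surface gamma(I) + R w is planar with normal n; it is the whole plane
   when I = R, and a strip of the plane otherwise. *)
Definition planar_cylinder (R : realType) (I : set R) (gamma : R -> 'rV[R]_3)
    (w n : 'rV[R]_3) : Prop :=
  let S := cyl_map gamma w @` cyl_dom I in
  exists c, S `<=` plane n c /\ (I = setT -> S = plane n c).

(* Every plane is a lambda-translator for lambda = - <N, v>, since K = 0.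
   This is the case of the planes that are not orthogonal to v and that are not
   ruled by lines parallel to v. *)
Definition oblique_plane (R : realType) (v : 'rV[R]_3) (lambda : R)
    (I : set R) (gamma : R -> 'rV[R]_3) (w : 'rV[R]_3) : Prop :=
  exists n, [/\ unit_vector n, planar_cylinder I gamma w n,
                ~ parallel n v, ~ parallel w v & lambda = - dot n v].

(* Main.v *)
Require Import Defs.
From HB Require Import structures.
From mathcomp Require Import all_boot all_order all_algebra.
From mathcomp Require Import all_classical all_reals all_analysis.
From mathcomp Require Import ring lra.
Set Implicit Arguments.
Unset Strict Implicit.
Unset Printing Implicit Defensive.
Import Order.TTheory GRing.Theory Num.Theory.
Import numFieldNormedType.Exports.
Local Open Scope classical_set_scope.
Local Open Scope ring_scope.

(** The normal is constant along the rulings of a cylinder, so its Gauss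
    curvature vanishes ([gauss_curvature_cyl_map]), and the translator equation
    reduces to [dot N v = - lambda]. Fix a base point of each ruling; the normal
    is then a continuous curve of unit vectors orthogonal to [w].

    If [w] is parallel to [v], then [N] is orthogonal to [v] and [lambda = 0].

    Otherwise [w] and [v] are independent, and [N] has constant dot products with
    both. A unit vector with prescribed dot products with two independent vectors
    is determined up to a reflection, and a continuous curve on an interval
    cannot jump from one of the two solutions to the other: [N] is a constant
    vector [n] ([eq_unit_curve]). Then [dot (gamma s) n] has derivative zero, so
    that the surface lies in a plane of normal [n]. When the curve is defined on
    the whole line, the same rigidity, applied to the tangent [gamma'] and the
    independent pair [w], [n], shows that [gamma] is a full straight line, hence
    that the surface is the full plane ([planar_cylinder_const_normal]). If [n]
    is parallel to [v] then [n = v] or [n = - v], which gives [lambda = -1] or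
    [lambda = 1]; if not, the plane is oblique.

    The reflection ambiguity is a sign of the scalar triple product, whose square
    is a Gram determinant: this is how the rigidity is proved. *)

(** * Dot products and triple products *)

Definition triple {R : realType} (x y z : 'rV[R]_3) : R :=
  x 0 0 * (y 0 1 * z 0 2 - y 0 2 * z 0 1)
  - x 0 1 * (y 0 0 * z 0 2 - y 0 2 * z 0 0)
  + x 0 2 * (y 0 0 * z 0 1 - y 0 1 * z 0 0).

Lemma dotE {R : realType} (x y : 'rV[R]_3) :
  dot x y = x 0 0 * y 0 0 + x 0 1 * y 0 1 + x 0 2 * y 0 2.
Proof.
rewrite /dot !big_ord_recl big_ord0 addr0 addrA.
by congr (_ + x _ _ * y _ _ + x _ _ * y _ _); apply/val_inj.
Qed.

Lemma dotC {R : realType} (x y : 'rV[R]_3) : dot x y = dot y x.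
Proof. by rewrite !dotE; ring. Qed.

Lemma dotDl {R : realType} (x y z : 'rV[R]_3) :
  dot (x + y) z = dot x z + dot y z.
Proof. by rewrite !dotE !mxE; ring. Qed.

Lemma dotZl {R : realType} (k : R) (x z : 'rV[R]_3) :
  dot (k *: x) z = k * dot x z.
Proof. by rewrite !dotE !mxE; ring. Qed.

Lemma dotBl {R : realType} (x y z : 'rV[R]_3) :
  dot (x - y) z = dot x z - dot y z.
Proof. by rewrite !dotE !mxE; ring. Qed.

Lemma dot_eq0 {R : realType} (x : 'rV[R]_3) : dot x x = 0 -> x = 0.
Proof.
move=> /psumr_eq0P x0; apply/rowP => i; rewrite mxE.
have /eqP := x0 (fun j _ => sqr_ge0 (x ord0 j)) i isT.
by rewrite mulf_eq0 orbb => /eqP.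
Qed.

Lemma tripleBr {R : realType} (a b x y : 'rV[R]_3) :
  triple a b (x - y) = triple a b x - triple a b y.
Proof. by rewrite /triple !mxE; ring. Qed.

(** The square of a 3 x 3 determinant is the Gram determinant of its rows, so
    that dot products determine the triple product up to sign. *)
Lemma triple_sqr {R : realType} (x y z : 'rV[R]_3) :
  triple x y z ^+ 2 =
    dot x x * (dot y y * dot z z - dot y z ^+ 2)
    - dot x y * (dot x y * dot z z - dot y z * dot x z)
    + dot x z * (dot x y * dot y z - dot y y * dot x z).
Proof. by rewrite !dotE /triple; ring. Qed.

(** Cramer's rule for the coordinates of [y] in the frame [a, b, c], paired
    with [y]: a vector orthogonal to a frame vanishes. *)
Lemma triple_cramer {R : realType} (a b c y : 'rV[R]_3) :
  triple a b c * dot y y =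
    dot y a * triple y b c + dot y b * triple a y c + dot y c * triple a b y.
Proof. by rewrite !dotE /triple; ring. Qed.

(** Equality case of Cauchy-Schwarz: for unit vectors the Gram determinant is
    the squared length of [w - dot w v *: v]. *)
Lemma gram_eq0_parallel {R : realType} (w v : 'rV[R]_3) :
  unit_vector w -> unit_vector v -> 1 - dot w v ^+ 2 = 0 -> parallel w v.
Proof.
rewrite /unit_vector => w1 v1 g0; exists (dot w v).
apply/eqP; rewrite -subr_eq0; apply/eqP/dot_eq0.
have -> (k : R) : dot (w - k *: v) (w - k *: v) =
    dot w w - 2 * k * dot w v + k ^+ 2 * dot v v.
  by rewrite !dotE !mxE; ring.
by rewrite w1 v1 -g0; ring.
Qed.

(** * Constancy of curves on an interval *)

Lemma continuous_triple {R : realType} (a b : 'rV[R]_3) (M : R -> 'rV[R]_3)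
    (s : R) :
  {for s, continuous M} -> {for s, continuous (fun t => triple a b (M t))}.
Proof.
move=> cM.
have cMi i : M t 0 i @[t --> s] --> M s 0 i.
  exact: (cvg_comp _ _ cM (@coord_continuous R 1 3 0 i (M s))).
rewrite /triple /prop_for /continuous_at.
apply: cvgD; first apply: cvgB.
- by apply: cvgMl_tmp; apply: cvgB; apply: cvgMl_tmp; exact: cMi.
- by apply: cvgMl_tmp; apply: cvgB; apply: cvgMl_tmp; exact: cMi.
- by apply: cvgMl_tmp; apply: cvgB; apply: cvgMl_tmp; exact: cMi.
Qed.

Lemma interval_constant {R : realType} {T : Type} (I : set R) (f : R -> T) :
  is_interval I ->
  (forall s t, s <= t -> (forall x, x \in `[s, t] -> I x) -> f s = f t) ->
  forall s t, I s -> I t -> f s = f t.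
Proof.
move=> itvI fst.
have wl s t : I s -> I t -> s <= t -> f s = f t.
  move=> Is It st; apply: fst => // x.
  by rewrite in_itv/= => xst; exact: (itvI s t).
by move=> s t Is It; have [/wl->//|/ltW/wl->//] := leP s t.
Qed.

(** If two values differed they would be opposite, and the intermediate value
    theorem would provide a zero of [f], which forces [c = 0] and [f = 0]. *)
Lemma eq_continuous_sqr {R : realType} (I : set R) (f : R -> R) (c : R) :
  is_interval I -> (forall s, I s -> {for s, continuous f}) ->
  (forall s, I s -> f s ^+ 2 = c) ->
  forall s t, I s -> I t -> f s = f t.
Proof.
move=> itvI cf fc; apply: interval_constant => // s t st sub.
have Is : I s by apply: sub; rewrite in_itv/= lexx.
have It : I t by apply: sub; rewrite in_itv/= lexx andbT.
apply/eqP/negPn/negP => fst.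
have /eqP : f s ^+ 2 = f t ^+ 2 by rewrite !fc.
rewrite eqf_sqr (negPf fst)/= => /eqP fsN.
have [||z /sub Iz fz0] := @IVT R f s t 0 st.
- by apply/continuous_in_subspaceT => z; rewrite inE/= => /sub; exact: cf.
- rewrite fsN ge_min le_max.
  by case: (leP 0 (f t)) => ft; rewrite ?oppr_le0 ?oppr_ge0 ?ft ?(ltW ft) ?orbT.
have c0 : c = 0 by rewrite -(fc _ Iz) fz0 expr0n.
have f0 u : I u -> f u = 0.
  by move=> /fc/eqP; rewrite c0 sqrf_eq0 => /eqP.
by move: fst; rewrite !f0// eqxx.
Qed.

(** Rigidity: the dot products fix [triple a b (M s) ^+ 2], hence by continuity
    [triple a b (M s)] itself, and a vector orthogonal to [a] and [b] with zero
    triple product against them vanishes when [a] and [b] are independent. *)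
Lemma eq_unit_curve {R : realType} (I : set R) (M : R -> 'rV[R]_3)
    (a b : 'rV[R]_3) (k l : R) :
  is_interval I -> (forall s, I s -> {for s, continuous M}) ->
  dot a a * dot b b - dot a b ^+ 2 != 0 ->
  (forall s, I s -> [/\ unit_vector (M s), dot (M s) a = k & dot (M s) b = l]) ->
  forall s t, I s -> I t -> M s = M t.
Proof.
move=> itvI cM gab Mab s t Is It.
have : triple a b (M s) = triple a b (M t).
  apply: (eq_continuous_sqr itvI (f := fun u => triple a b (M u))) Is It.
    by move=> u Iu; exact/continuous_triple/cM.
  move=> u /Mab[M1 Ma Mb].
  by rewrite triple_sqr M1 !(dotC _ (M u)) Ma Mb.
have [_ sa sb] := Mab _ Is; have [_ ta tb] := Mab _ It.
move=> /eqP; rewrite -subr_eq0 -tripleBr => /eqP tr0.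
apply/eqP; rewrite -subr_eq0; apply/eqP/dot_eq0.
have da : dot (M s - M t) a = 0 by rewrite dotBl sa ta subrr.
have db : dot (M s - M t) b = 0 by rewrite dotBl sb tb subrr.
apply: (mulfI gab); rewrite mulr0.
have := triple_sqr a b (M s - M t).
rewrite tr0 expr0n/= !(dotC _ (M s - M t)) da db => /esym h.
by rewrite -[RHS]h; ring.
Qed.

Lemma derive1_dot {R : realType} (g : R -> 'rV[R]_3) (n : 'rV[R]_3) (s : R) :
  derivable g s 1 ->
  is_derive s 1 (fun t => dot (g t) n) (dot (derive1 g s) n).
Proof.
move=> dg; have dgi i : is_derive s 1 (fun t => g t 0 i) (derive1 g s 0 i).
  apply: DeriveDef; first by move/derivable_mxP : dg; apply.
  by rewrite derive1E derive_mx// mxE.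
rewrite (_ : (fun t => dot (g t) n) = (fun t => n 0 0 * g t 0 0) +
  (fun t => n 0 1 * g t 0 1) + (fun t => n 0 2 * g t 0 2)); last first.
  by apply/funext => t; rewrite dotE !fctE; ring.
have dsc i : is_derive s 1 (fun t => n 0 i * g t 0 i) (n 0 i * derive1 g s 0 i).
  exact: (is_deriveZ _ (dgi i)).
apply: is_derive_eq; rewrite dotE; ring.
Qed.

Lemma eq_curve_derive0 {R : realType} (I : set R) (f : R -> R) :
  is_interval I -> (forall s, I s -> is_derive s 1 f 0) ->
  forall s t, I s -> I t -> f s = f t.
Proof.
move=> itvI df; apply: interval_constant => // s t st sub.
have [||z _] := @MVT_segment R f (fun=> 0) s t st.
- by move=> x xst; apply/df/sub; exact: subset_itv_oo_cc xst.
- by apply: derivable_within_continuous => x /sub/df.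
by rewrite mul0r => /eqP; rewrite subr_eq0 => /eqP.
Qed.

(** * Geometry of cylinders *)

Lemma continuous_slice {R : realType} {V : normedModType R} (f : R * R -> V)
    (s t : R) :
  {for (s, t), continuous f} -> {for s, continuous (fun u => f (u, t))}.
Proof.
move=> cf; apply: (cvg_comp (fun u => (u, t)) f) cf.
exact: (cvg_pair cvg_id (cvg_cst t)).
Qed.

Lemma du_cyl_map {R : realType} (gamma : R -> 'rV[R]_3) (w : 'rV[R]_3) :
  du (cyl_map gamma w) = fun p => derive1 gamma p.1.
Proof.
apply/funext => p; rewrite /du /derive /derive1 /cyl_map.
set d := (fun _ : R => _ *: _); set d' := (fun _ : R => _ *: _).
suff -> : d = d' by []; apply/funext => h; rewrite /d /d' /=.
congr (_ *: _); rewrite scaler0 add0r [h *: 1]mulr1.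
by rewrite opprD addrACA subrr addr0.
Qed.

Lemma derive_affine {R : realType} (f : R * R -> 'rV[R]_3) p u l :
  (forall h, f (h *: u + p) - f p = h *: l) -> 'D_u f p = l.
Proof.
move=> fl; rewrite /derive; apply/cvg_lim => //.
apply: (@cvg_trans _ ((cst l) @ (0 : R)^')); last exact: cvg_cst.
apply: near_eq_cvg; near=> h; rewrite fl scalerA mulVf ?scale1r//.
near: h; exact: nbhs_dnbhs_neq.
Unshelve. all: by end_near. Qed.

Lemma dv_cyl_map {R : realType} (gamma : R -> 'rV[R]_3) (w : 'rV[R]_3) :
  dv (cyl_map gamma w) = cst w.
Proof.
apply/funext => p; apply: derive_affine => h; rewrite /cyl_map/=.
by rewrite scaler0 add0r opprD addrACA subrr add0r -scalerBl addrK [h *: 1]mulr1.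
Qed.

(** The tangent plane does not vary along a ruling, so that the mixed second
    derivative [dv (du X)] vanishes as well as [dv (dv X)]: the second
    fundamental form is degenerate. *)
Lemma gauss_curvature_cyl_map {R : realType} (gamma : R -> 'rV[R]_3)
    (w : 'rV[R]_3) (N : R * R -> 'rV[R]_3) (p : R * R) :
  gauss_curvature (cyl_map gamma w) N p = 0.
Proof.
have f0 : dv (du (cyl_map gamma w)) p = 0.
  rewrite du_cyl_map; apply: derive_affine => h /=.
  by rewrite !scaler0 add0r subrr.
have g0 : dv (dv (cyl_map gamma w)) p = 0.
  by rewrite dv_cyl_map; apply: derive_affine => h /=; rewrite !scaler0 subrr.
rewrite /gauss_curvature f0 g0.
have -> : dot 0 (N p) = 0 by rewrite dotE !mxE; ring.
by rewrite mulr0 expr0n/= subrr mul0r.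
Qed.

(** Differentiating [dot (gamma s) n] places the surface in a plane. When
    [I = setT], the tangent [gamma'] is a unit vector orthogonal to both [w] and
    [n], hence a constant [T] by [eq_unit_curve], and [gamma] is the line
    [gamma s0 + (s - s0) T]; the orthonormal frame [T, w, n] then gives the
    parameters of any point of the plane. *)
Lemma planar_cylinder_const_normal {R : realType} (I : set R)
    (gamma : R -> 'rV[R]_3) (w n : 'rV[R]_3) :
  cylindrical I gamma w ->
  (forall s, I s -> {for s, continuous (derive1 gamma)}) ->
  unit_vector n -> dot w n = 0 ->
  (forall s, I s -> dot (derive1 gamma s) n = 0) ->
  planar_cylinder I gamma w n.
Proof.
move=> [[_ itvI [s0 Is0]] w1 dgamma [cw gammaw]] cgamma n1 wn Tn.
have gn s : I s -> dot (gamma s) n = dot (gamma s0) n.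
  move=> Is; apply: (@eq_curve_derive0 _ I (fun u => dot (gamma u) n)) => // u Iu.
  rewrite -(Tn _ Iu); apply: derive1_dot; exact: (dgamma _ Iu).1.
exists (dot (gamma s0) n); split => [_ [[s t] /= Is <-]|IT].
  by rewrite /plane/= dotDl dotZl wn mulr0 addr0 gn.
have {}gammaw s : I s -> dot (gamma s) w = cw by move=> /gammaw.
have Tw s : I s -> dot (derive1 gamma s) w = 0.
  move=> Is.
  have [dg _] := dgamma _ Is; have h := derive1_dot w dg.
  rewrite -(derive_val (is_derive := h)).
  rewrite (_ : (fun t => _) = cst cw) ?derive_cst//.
  by apply/funext => t; rewrite gammaw// IT.
pose T := derive1 gamma s0.
have TE s : derive1 gamma s = T.
  apply: (@eq_unit_curve _ I _ w n 0 0) => //; last by rewrite IT.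
    by rewrite w1 n1 wn; apply/eqP; lra.
  by move=> u Iu; split; [exact: (dgamma _ Iu).2|exact: Tw|exact: Tn].
have T1 : dot T T = 1 := (dgamma _ Is0).2.
have gT s : dot (gamma s) T = dot (gamma s0) T + (s - s0).
  have := @eq_curve_derive0 _ I (fun u => dot (gamma u) T - u) itvI.
  move=> /(_ _ s s0) H.
  have {H} : dot (gamma s) T - s = dot (gamma s0) T - s0.
    apply: H => [u Iu||]; rewrite ?IT//.
    apply: is_derive_eq (is_deriveB (derive1_dot T (dgamma _ Iu).1) _) _.
    by rewrite TE T1 subrr.
  lra.
apply/seteqP; split => [_ [[s t] /= Is <-]|x /= xn].
  by rewrite /plane/= dotDl dotZl wn mulr0 addr0 gn.
pose s := s0 + dot (x - gamma s0) T; pose t := dot (x - gamma s) w.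
exists (s, t); first by rewrite /cyl_dom/= IT.
apply/esym/eqP; rewrite -subr_eq0; apply/eqP/dot_eq0.
have TwE : dot T w = 0 by exact: Tw.
have TnE : dot T n = 0 by exact: Tn.
(* The difference of the two points is orthogonal to the frame [T, w, n]. *)
have trN0 : triple T w n != 0.
  by rewrite -sqrf_eq0 triple_sqr T1 w1 n1 TwE TnE wn; apply/eqP; lra.
apply: (mulfI trN0); rewrite mulr0 triple_cramer.
have -> : dot (x - cyl_map gamma w (s, t)) T = 0.
  rewrite /cyl_map/= dotBl dotDl dotZl (dotC w) TwE gT /s dotBl; lra.
have -> : dot (x - cyl_map gamma w (s, t)) w = 0.
  rewrite /cyl_map/= dotBl dotDl dotZl w1 /t dotBl; lra.
have -> : dot (x - cyl_map gamma w (s, t)) n = 0.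
  rewrite /cyl_map/= dotBl dotDl dotZl wn gn ?IT//; rewrite /plane/= in xn.
  rewrite xn; lra.
by rewrite !mul0r !addr0.
Qed.

Lemma planar_cylinderZ {R : realType} (I : set R)
    (gamma : R -> 'rV[R]_3) (w n : 'rV[R]_3) (k : R) :
  k != 0 -> planar_cylinder I gamma w (k *: n) -> planar_cylinder I gamma w n.
Proof.
move=> k0 [c pc]; exists (k^-1 * c).
suff -> : plane n (k^-1 * c) = plane (k *: n) c by [].
apply/seteqP; split => x /=; rewrite /plane/= (dotC _ (k *: n)) dotZl (dotC n).
  by move=> ->; rewrite mulVKf.
by move=> <-; rewrite mulKf.
Qed.

Theorem theorem2p1 (R : realType) (v : 'rV[R]_3) (lambda : R) (I : set R)
    (gamma : R -> 'rV[R]_3) (w : 'rV[R]_3) (N : R * R -> 'rV[R]_3)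
    (hv : unit_vector v)
    (hcyl : cylindrical I gamma w)
    (htr : lambda_translator v lambda (cyl_dom I) (cyl_map gamma w) N) :
  (planar_cylinder I gamma w v /\ (lambda = 1 \/ lambda = -1))
  \/ (lambda = 0 /\ parallel w v)
  \/ oblique_plane v lambda I gamma w.
Proof.
have [[_ itvI [s0 Is0]] w1 _ _] := hcyl.
have [[_ [C1 _ _] _] hN hK] := htr.
have cT s : I s -> {for s, continuous (derive1 gamma)}.
  move=> Is; have [_ _ + _] := C1 (s, 0) Is.
  rewrite du_cyl_map => cT.
  exact: (continuous_slice cT).
have cN s : I s -> {for s, continuous (fun u => N (u, 0))}.
  move=> Is; have [_ _ _ cN] := hN (s, 0) Is.
  exact: (continuous_slice cN).
have Nv s : I s -> [/\ unit_vector (N (s, 0)), dot (N (s, 0)) w = 0 &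
    dot (N (s, 0)) v = - lambda].
  move=> Is; have [N1 _ + _] := hN (s, 0) Is.
  rewrite dv_cyl_map; split=> //.
  by have := hK (s, 0) Is; rewrite gauss_curvature_cyl_map; lra.
have NT s : I s -> dot (N (s, 0)) (derive1 gamma s) = 0.
  by move=> Is; have [_ + _ _] := hN (s, 0) Is; rewrite du_cyl_map.
pose n := N (s0, 0); have [n1 nw nv] := Nv _ Is0.
have [wv|nwv] := pselect (parallel w v).
  right; left; split=> //; have [k wk] := wv.
  have k0 : k != 0.
    apply/eqP => k0; move: w1; rewrite wk k0 scale0r /unit_vector dotE !mxE.
    by move/eqP; rewrite !mul0r !addr0 eq_sym oner_eq0.
  have := nw; rewrite dotC {1}wk dotZl dotC nv => /eqP.
  by rewrite mulf_eq0 (negPf k0)/= oppr_eq0 => /eqP.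
have NE s : I s -> N (s, 0) = n.
  move=> Is; apply: (@eq_unit_curve _ I (fun u => N (u, 0)) w v 0 (- lambda)) => //.
  rewrite w1 hv mulr1; apply/eqP => g0.
  exact/nwv/gram_eq0_parallel.
have pn : planar_cylinder I gamma w n.
  apply: planar_cylinder_const_normal => //; first by rewrite dotC.
  by move=> s Is; rewrite dotC -(NE _ Is) NT.
have [[k nk]|nnv] := pselect (parallel n v); last first.
  by right; right; exists n; split=> //; rewrite nv opprK.
left; have kl : k = - lambda.
  by rewrite -nv -/n nk dotZl hv mulr1.
have k2 : k ^+ 2 = 1.
  have : dot n n = 1 := n1.
  by rewrite nk dotZl dotC dotZl hv mulr1.
have k0 : k != 0 by rewrite -sqrf_eq0 k2 oner_eq0.
split; first by apply: (@planar_cylinderZ _ _ _ _ _ k) => //; rewrite -nk.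
have -> : lambda = - k by rewrite kl opprK.
move/eqP : k2; rewrite sqrf_eq1 => /orP[]/eqP ->; first by right.
by left; rewrite opprK.
Qed.
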